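(* Let $\mathcal P\subseteq\mathcal U$ be an arbitrary graph class. Then the following are equivalent: (i) $\mathcal P$ is finite. (ii) There exists $n_0$ such that, for every graph $G$, $|G|\ge n_0$ implies $G\notin\mathcal P$. (iii) $\widehat{\mathcal P}=\emptyset$.
   Context: All graphs are finite and simple (with at least one vertex). $\mathcal U$ is the set of all unlabelled graphs (isomorphism classes of graphs), and $|G|$ is the number of vertices of $G$. A graph class is a subset of $\mathcal U$. For graphs $F,G$, $t(F,G)$ is the probability that a uniformly random map $V(F)\to V(G)$ is a graph homomorphism. The space $\overline{\mathcal U}$: embed $\mathcal U$ in $[0,1]^{\mathcal U}\times[0,1]$ by $G\mapsto((t(F,G))_{F\in\mathcal U},1/|G|)$ and let $\overline{\mathcal U}$ be the closure of the image; it is a compact metrizable space in which $\mathcal U$ is a countable, discrete, dense, open subset. The elements of $\widehat{\mathcal U}:=\overline{\mathcal U}\setminus\mathcal U$ are called graph limits. A sequence of graphs $G_n$ converges to a graph limit $\Gamma$ iff $|G_n|\to\infty$ and $t(F,G_n)\to t(F,\Gamma)$ for every graph $F$, where $t(F,\cdot)$ is extended to $\overline{\mathcal U}$ by continuity. For a graph class $\mathcal P$, $\overline{\mathcal P}$ is its closure in $\overline{\mathcal U}$ and $\widehat{\mathcal P}:=\overline{\mathcal P}\cap\widehat{\mathcal U}$, i.e. the set of graph limits that are limits of sequences of graphs in $\mathcal P$. *)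

(* Defs.v *)
From HB Require Import structures.
From mathcomp Require Import all_boot all_order all_algebra generic_quotient.
From mathcomp Require Import all_classical all_reals all_analysis.

Set Implicit Arguments.
Unset Strict Implicit.
Unset Printing Implicit Defensive.

Import Order.TTheory GRing.Theory Num.Theory.
Import numFieldNormedType.Exports.

Local Open Scope classical_set_scope.
Local Open Scope ring_scope.
Local Open Scope quotient_scope.

(* A graph with tag n has vertex set 'I_n.+1, so every graph has at least one
   vertex; its edges are two-element sets of vertices. *)
Definition edge_sets n :=
  {E : {set {set 'I_n.+1}} | [forall e in E, #|e| == 2%N]}.

Definition graph := {n : nat & edge_sets n}.

Definition vertex (G : graph) : finType := 'I_(tag G).+1.

Definition edges (G : graph) : {set {set vertex G}} := \val (tagged G).

Definition adj (G : graph) (x y : vertex G) : bool :=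
  [set x; y]%SET \in edges G.

Definition order (G : graph) : nat := #|vertex G|.

Definition is_hom (F G : graph) (f : vertex F -> vertex G) : bool :=
  [forall x, forall y, adj x y ==> adj (f x) (f y)].

Definition hom_density (R : realType) (F G : graph) : R :=
  #|[set f : {ffun vertex F -> vertex G} | is_hom f]%SET|%:R
    / #|{ffun vertex F -> vertex G}|%:R.

Definition isomorphic : rel graph := fun F G =>
  `[< exists f : vertex F -> vertex G,
        bijective f /\ forall x y, adj (f x) (f y) = adj x y >].

Lemma adj_irr (G : graph) (x : vertex G) : ~~ adj x x.
Proof.
have /forall_inP edge2 := valP (tagged G).
by apply/negP => /edge2; rewrite finset.setUid cards1.
Qed.

Lemma adj_sym (G : graph) : symmetric (@adj G).
Proof. by move=> x y; rewrite /adj finset.setUC. Qed.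

Lemma isomorphic_refl : reflexive isomorphic.
Proof. by move=> G; apply/asboolP; exists id; split=> //; exists id. Qed.

Lemma isomorphic_sym : symmetric isomorphic.
Proof.
suff h F G : isomorphic F G -> isomorphic G F by move=> F G; apply/idP/idP; apply: h.
move=> /asboolP[f [[g fK gK] fE]]; apply/asboolP; exists g; split.
  by exists f.
by move=> x y; rewrite -fE !gK.
Qed.

Lemma isomorphic_trans : transitive isomorphic.
Proof.
move=> G F H /asboolP[f [f_bij fE]] /asboolP[g [g_bij gE]].
apply/asboolP; exists (g \o f); split; first exact: bij_comp.
by move=> x y /=; rewrite gE fE.
Qed.

Canonical isomorphic_equiv :=
  EquivRel isomorphic isomorphic_refl isomorphic_sym isomorphic_trans.

Definition unlabelled := {eq_quot isomorphic}.

(* These are defined through the chosen representatives; [uorder_pi] and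
   [udensity_pi] show that they do not depend on that choice. *)
Definition uorder (G : unlabelled) : nat := order (repr G).

Definition udensity (R : realType) (F G : unlabelled) : R :=
  hom_density R (repr F) (repr G).

Lemma isomorphic_order F G : isomorphic F G -> order F = order G.
Proof. by move=> /asboolP[f [/bij_eq_card fE _]]. Qed.

Lemma isomorphic_hom_density (R : realType) F F' G G' :
  isomorphic F F' -> isomorphic G G' ->
  hom_density R F G = hom_density R F' G'.
Proof.
move=> iF iG.
have cardE : #|{ffun vertex F -> vertex G}| = #|{ffun vertex F' -> vertex G'}|.
  rewrite !card_ffun.
  by have := isomorphic_order iF; have := isomorphic_order iG; rewrite /order => -> ->.
rewrite /hom_density cardE; congr (_%:R / _).
suff h A A' B B' : isomorphic A A' -> isomorphic B B' ->
    (#|[set f : {ffun vertex A -> vertex B} | is_hom f]%SET|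
     <= #|[set f : {ffun vertex A' -> vertex B'} | is_hom f]%SET|)%N.
  by apply/eqP; rewrite eqn_leq !h // isomorphic_sym.
move=> /asboolP[u [[u' uK u'K] uE]] /asboolP[v [v_bij vE]].
pose T (f : {ffun vertex A -> vertex B}) : {ffun vertex A' -> vertex B'} :=
  [ffun x => v (f (u' x))].
have T_inj : injective T.
  move=> f g /ffunP fg; apply/ffunP => x; apply: (bij_inj v_bij).
  by have := fg (u x); rewrite !ffunE uK.
rewrite -(card_imset _ T_inj); apply/subset_leq_card/fintype.subsetP => g.
move=> /imsetP[f fhom ->]; move: fhom.
rewrite !finset.inE => /forallP fh; apply/forallP => x; apply/forallP => y.
apply/implyP => xy; rewrite !ffunE vE.
by move: (fh (u' x)) => /forallP/(_ (u' y))/implyP; apply; rewrite -uE !u'K.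
Qed.

Lemma isomorphic_repr_pi (G : graph) : isomorphic (repr (\pi_unlabelled G)) G.
Proof. by apply/(@eqmodP _ isomorphic_equiv); rewrite reprK. Qed.

Lemma uorder_pi (G : graph) : uorder (\pi_unlabelled G) = order G.
Proof. exact/isomorphic_order/isomorphic_repr_pi. Qed.

Lemma udensity_pi (R : realType) (F G : graph) :
  udensity R (\pi_unlabelled F) (\pi_unlabelled G) = hom_density R F G.
Proof. by apply: isomorphic_hom_density; apply: isomorphic_repr_pi. Qed.

Lemma hom_density_itv (R : realType) F G : 0 <= hom_density R F G <= 1.
Proof.
rewrite /hom_density divr_ge0 ?ler0n //=.
have gt0 : (0 < #|{ffun vertex F -> vertex G}|)%N.
  by apply/card_gt0P; exists [ffun=> ord0].
by rewrite ler_pdivrMr ?ltr0n // mul1r ler_nat max_card.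
Qed.

(* The values of [embed] lie in the cube [0, 1]^unlabelled * [0, 1], which is
   closed in this space, so closures taken here and in the cube agree. *)
Definition ambient (R : realType) := ({ptws unlabelled -> R} * R)%type.

Definition embed (R : realType) (G : unlabelled) : ambient R :=
  (fun F => udensity R F G, (uorder G)%:R^-1).
Arguments embed : clear implicits.

Definition graph_space (R : realType) : set (ambient R) :=
  closure (range (embed R)).
Arguments graph_space : clear implicits.

Definition graph_limits (R : realType) : set (ambient R) :=
  graph_space R `\` range (embed R).
Arguments graph_limits : clear implicits.

Definition class_closure (R : realType) (P : set unlabelled) :
    set (ambient R) :=
  closure (embed R @` P).
Arguments class_closure : clear implicits.

Definition class_limits (R : realType) (P : set unlabelled) :
    set (ambient R) :=
  class_closure R P `&` graph_limits R.
Arguments class_limits : clear implicits.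

(* Main.v *)
Require Import Defs.
From mathcomp Require Import all_boot all_order all_algebra.
From mathcomp Require Import all_classical all_reals all_analysis.
Local Open Scope classical_set_scope.

Import Order.TTheory GRing.Theory Num.Theory.
Import numFieldNormedType.Exports.
Local Open Scope ring_scope.
Local Open Scope quotient_scope.

(** The order of a graph is visible in the embedding, as the reciprocal of the
    last coordinate, and only finitely many graphs have order below a given
    bound ([finite_bounded_order]).  Hence a class is finite iff its orders are
    bounded, and everything rests on telling bounded classes from unbounded
    ones by their limits.

    A bounded class is finite, so its image is closed in the Hausdorff ambient
    space; the closure then adds nothing and there is no limit.  Conversely, if
    the orders in a class are unbounded, choose graphs [G n] in it with
    [n < uorder (G n)].  Their images lie in the compact unit cube,
    so they have a cluster point ([compact_unit_cube]).  The last coordinate of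
    that point is the limit of the reciprocals of the orders, namely 0, whereas
    every graph has a nonzero last coordinate; so the point is a graph limit of
    the class ([unbounded_class_limit]). *)

Lemma uorderE (G : unlabelled) : uorder G = (tag (repr G)).+1.
Proof. exact: card_ord. Qed.

Lemma uorder_gt0 (G : unlabelled) : (0 < uorder G)%N.
Proof. by rewrite uorderE. Qed.

(** Up to isomorphism a graph of order [m.+1] is one of the finitely many edge
    sets on ['I_m.+1]. *)
Lemma finite_bounded_order (n : nat) :
  finite_set [set G : unlabelled | (uorder G < n)%N].
Proof.
pose U := \bigcup_(m in `I_n)
  ((fun E => \pi_unlabelled (existT edge_sets m E)) @` setT).
apply: (@sub_finite_set _ _ U).
  move=> G /= Gn; exists (tag (repr G)).
    by move: Gn; rewrite uorderE => /ltnW.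
  by exists (tagged (repr G)) => //; case: (repr G) (reprK G).
apply: bigcup_finite => [|m _]; first exact: finite_II.
exact/finite_image/finite_finset.
Qed.

Lemma finite_class_bounded (P : set unlabelled) :
  finite_set P <->
  exists n0 : nat, forall G : unlabelled, (n0 <= uorder G)%N -> ~ P G.
Proof.
split=> [/finite_seqP[s ->]|[n0 Pn0]].
  exists (\max_(G <- s) uorder G).+1 => G /= + Gs.
  by rewrite ltnNge (leq_bigmax_seq _ Gs).
apply: sub_finite_set (finite_bounded_order n0) => G PG /=.
by rewrite ltnNge; apply/negP => /Pn0.
Qed.

Lemma hausdorff_pair (U V : topologicalType) :
  hausdorff_space U -> hausdorff_space V -> hausdorff_space (U * V)%type.
Proof.
move=> hU hV [p1 p2] [q1 q2] pq; congr (_, _).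
- apply: hU => A B pA qB.
  have [||[x y] [/= [Ax _] [Bx _]]] := pq (A `*` setT) (B `*` setT).
  + by exists (A, setT) => //; split=> //; exact: filterT.
  + by exists (B, setT) => //; split=> //; exact: filterT.
  + by exists x.
- apply: hV => A B pA qB.
  have [||[x y] [/= [_ Ay] [_ By]]] := pq (setT `*` A) (setT `*` B).
  + by exists (setT, A) => //; split=> //; exact: filterT.
  + by exists (setT, B) => //; split=> //; exact: filterT.
  + by exists y.
Qed.

Lemma hausdorff_ambient (R : realType) : hausdorff_space (ambient R).
Proof.
apply: hausdorff_pair; last exact: Rhausdorff.
by apply: hausdorff_product => F; exact: Rhausdorff.
Qed.

Definition unit_cube (R : realType) : set (ambient R) :=
  [set f | forall F, `[0, 1]%classic (f F)] `*` `[0, 1]%classic.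

(** A product of compact intervals is compact, by Tychonoff's theorem. *)
Lemma compact_unit_cube (R : realType) : compact (unit_cube R).
Proof.
apply: compact_setX; last exact: segment_compact.
exact: (tychonoff (fun _ : unlabelled => @segment_compact R 0 1)).
Qed.

Lemma embed_unit_cube (R : realType) (G : unlabelled) :
  unit_cube R (embed R G).
Proof.
split=> [F|] /=; rewrite in_itv /=; first exact: hom_density_itv.
by rewrite invr_ge0 ler0n /= invf_le1 ?ltr0n ?ler1n uorder_gt0.
Qed.

(** A finite set is closed in a Hausdorff space, so the closure of the image
    contains only images of graphs. *)
Lemma finite_class_no_limit (R : realType) (P : set unlabelled) :
  finite_set P -> class_limits R P = set0.
Proof.
move=> finP; rewrite -subset0 => x [+ [_ xN]].
have /closure_id : closed (embed R @` P).
  move/hausdorff_accessible/accessible_finite_set_closed: (@hausdorff_ambient R).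
  by apply; exact: finite_image.
by rewrite /class_closure => <- [G _ Gx]; apply: xN; exists G.
Qed.

(** The limit is found as a cluster point of a sequence in the class with orders
    tending to infinity: its last coordinate is then a cluster point of the
    reciprocals of the orders, hence 0, which no graph attains. *)
Lemma unbounded_class_limit (R : realType) (P : set unlabelled) :
  (forall n : nat, exists2 G, P G & (n < uorder G)%N) ->
  class_limits R P !=set0.
Proof.
move=> unbP.
have /boolp.choice[G GP] : forall n : nat, exists G, P G /\ (n < uorder G)%N.
  by move=> n; have [H] := unbP n; exists H.
have [|x [_ xG]] := @compact_unit_cube R (embed R \o G @ \oo) _.
  by exists 0%N => // n _; exact: embed_unit_cube.
have xP : closure (embed R @` P) x.
  move=> B xB; apply: (xG _ _ _ xB).
  by exists 0%N => // n _; exists (G n) => //; have [] := GP n.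
have G0 : (fun n => (uorder (G n))%:R^-1 : R) @ \oo --> (0 : R).
  apply: (squeeze_cvgr _ (cvg_cst 0) (@cvg_harmonic R)).
  near=> n; rewrite invr_ge0 ler0n /= /harmonic.
  by rewrite lef_pV2 ?posrE ?ltr0n ?uorder_gt0 // ler_nat; have [] := GP n.
have x0 : 0 = x.2.
  apply: Rhausdorff; apply: (cvg_cluster G0) => A B GA xB.
  have [||y [Ay By]] := xG (snd @^-1` A) (snd @^-1` B).
  - exact: GA.
  - by apply: (@cvg_snd _ _ (nbhs x.1) (nbhs x.2)).
  - by exists y.2.
exists x; split=> //; split.
  by apply: closure_subset xP => _ [H _ <-]; exists H.
move=> [H _ Hx]; move: x0; rewrite -Hx /= => /esym/eqP.
by rewrite invr_eq0 pnatr_eq0 -leqn0 leqNgt uorder_gt0.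
Unshelve. all: by end_near.
Qed.

Theorem theorem1p5 (R : realType) (P : set unlabelled) :
  [<-> finite_set P;
       exists n0 : nat, forall G : unlabelled, (n0 <= uorder G)%N -> ~ P G;
       class_limits R P = set0].
Proof.
tfae.
- by move/finite_class_bounded.
- by move/finite_class_bounded; exact: finite_class_no_limit.
- move=> P0; apply/finite_class_bounded; apply: contrapT => unb.
  suff : class_limits R P !=set0 by rewrite P0 => -[].
  apply: unbounded_class_limit => n; apply: contrapT => nP.
  by apply: unb; exists n.+1 => G nG PG; apply: nP; exists G.
Qed.
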